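(* Let $d\ge2$, $R>0$, and let $A\subset\mathbb{R}^d$ be a body with $\mathrm{reach}(A)\ge R$. Then $A$ is an $R$-body and, for every $a\in\partial A$, the set $\mathcal{N}_R(A,a)$ is spherically convex.
   Context: A body is a nonempty closed subset of $\mathbb{R}^d$; $S^{d-1}$ the unit sphere; $B(x)=\{y:|y-x|<R\}$; $co(\cdot)$ convex hull. A body $A$ is an $R$-body if every $y\notin A$ lies in some open ball of radius $R$ disjoint from $A$. For $a\in\partial A$, $\mathcal{N}_R(A,a)=\{v\in S^{d-1}: A\cap B(a+Rv)=\emptyset\}$. A set $\mathcal K\subset S^{d-1}$ is spherically convex if $co(K)\cap S^{d-1}=\mathcal K$, where $K=\{\lambda v:\lambda\ge0,v\in\mathcal K\}$. $\mathrm{Unp}(A)$ is the set of points with a unique nearest point in $A$; $\mathrm{reach}(A,a)=\sup\{\rho>0:\{x:|x-a|<\rho\}\subset\mathrm{Unp}(A)\}$, $\mathrm{reach}(A)=\inf_{a\in A}\mathrm{reach}(A,a)$. *)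

(* Defs.v *)
From mathcomp Require Import all_boot all_order all_algebra.
From mathcomp Require Import all_classical all_reals ereal.
Set Implicit Arguments. Unset Strict Implicit. Unset Printing Implicit Defensive.
Import Order.TTheory GRing.Theory Num.Theory.
Local Open Scope classical_set_scope.
Local Open Scope ring_scope.

Section Defs.
Variables (R : realType) (d : nat).
Notation vec := 'rV[R]_d.

Definition edot (u v : vec) : R := \sum_(i < d) u 0 i * v 0 i.
Definition enorm (u : vec) : R := Num.sqrt (edot u u).
Definition edist (x y : vec) : R := enorm (x - y).

Definition eball (c : vec) (r : R) : set vec := [set y | edist y c < r].

Definition eclosed (A : set vec) : Prop :=
  forall x, ~ A x -> exists2 r, 0 < r & eball x r `&` A = set0.

Definition body (A : set vec) : Prop := A !=set0 /\ eclosed A.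

Definition boundary (A : set vec) : set vec :=
  [set a | forall r, 0 < r ->
     (eball a r `&` A) !=set0 /\ (eball a r `&` ~` A) !=set0].

Definition usphere : set vec := [set v | enorm v = 1].

Definition Rbody (Rad : R) (A : set vec) : Prop :=
  forall y, ~ A y -> exists x, eball x Rad y /\ eball x Rad `&` A = set0.

Definition normal_cone_R (Rad : R) (A : set vec) (a : vec) : set vec :=
  [set v | usphere v /\ A `&` eball (a + Rad *: v) Rad = set0].

Definition conv_hull (S : set vec) : set vec :=
  [set x | exists n (w : 'I_n -> R) (p : 'I_n -> vec),
     [/\ forall i, 0 <= w i, \sum_(i < n) w i = 1, forall i, S (p i)
       & x = \sum_(i < n) w i *: p i]].

Definition cone_of (K : set vec) : set vec :=
  [set x | exists lam v, [/\ 0 <= lam, K v & x = lam *: v]].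

Definition spherically_convex (K : set vec) : Prop :=
  conv_hull (cone_of K) `&` usphere = K.

Definition is_nearest (A : set vec) (x a : vec) : Prop :=
  A a /\ forall b, A b -> edist x a <= edist x b.
Definition Unp (A : set vec) : set vec :=
  [set x | exists a, is_nearest A x a /\ forall b, is_nearest A x b -> b = a].

Definition reach_at (A : set vec) (a : vec) : \bar R :=
  ereal_sup [set (rho%:E) | rho in [set rho : R | 0 < rho /\ eball a rho `<=` Unp A]].
Definition reach (A : set vec) : \bar R :=
  ereal_inf [set reach_at A a | a in A].

End Defs.

(* Main.v *)
(** The ball condition [A `&` eball (a + r v) r = set0] says that [a] is a
    nearest point of [a + r v].  The key fact, due to Federer, is that if this
    holds for some [0 < r < reach A] it holds up to the reach.  In place of
    Federer's differential equation argument, let [delta] be the distance to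
    [A] and [x0 = a + r v].  Where nearest points are unique and [delta > 0],
    [delta] grows at rate 1 in some direction, so for every [c < 1] the maximum
    of [delta z - c |z - x0|] over a closed ball of radius [h] around [x0] lies
    on the sphere.  Hence [delta] reaches [r + h] on that ball, and the only
    point where it can is [x0 + h v]. *)
From mathcomp Require Import all_boot all_order all_algebra.
From mathcomp Require Import all_classical all_reals ereal.
From mathcomp Require Import topology normedtype derive ring lra.
Require Import Defs.
Set Implicit Arguments. Unset Strict Implicit. Unset Printing Implicit Defensive.
Import Order.TTheory GRing.Theory Num.Theory numFieldNormedType.Exports.
Local Open Scope classical_set_scope.
Local Open Scope ring_scope.

(** * Inner product, Euclidean norm, and comparison with the sup norm *)

Section Euclidean.
Variables (R : realType) (d : nat).
Implicit Types (u v w x y z : 'rV[R]_d) (A K : set 'rV[R]_d).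

Lemma edotC u v : edot u v = edot v u.
Proof. by apply: eq_bigr => i _; rewrite mulrC. Qed.

Lemma edotDl u v w : edot (u + v) w = edot u w + edot v w.
Proof. by rewrite -big_split; apply: eq_bigr => i _; rewrite mxE mulrDl. Qed.

Lemma edotZl a u v : edot (a *: u) v = a * edot u v.
Proof. by rewrite /edot mulr_sumr; apply: eq_bigr => i _; rewrite mxE mulrA. Qed.

Lemma edotDr u v w : edot w (u + v) = edot w u + edot w v.
Proof. by rewrite edotC edotDl !(edotC w). Qed.

Lemma edotZr a u v : edot u (a *: v) = a * edot u v.
Proof. by rewrite edotC edotZl edotC. Qed.

Lemma edotNl u v : edot (- u) v = - edot u v.
Proof. by rewrite -scaleN1r edotZl mulN1r. Qed.

Lemma edotNr u v : edot u (- v) = - edot u v.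
Proof. by rewrite edotC edotNl edotC. Qed.

Lemma edot_sumr u n (c : 'I_n -> R) (p : 'I_n -> 'rV[R]_d) :
  edot u (\sum_(i < n) c i *: p i) = \sum_(i < n) c i * edot u (p i).
Proof.
have -> : edot u (\sum_(i < n) c i *: p i) = \sum_(i < n) edot u (c i *: p i).
  apply: (big_morph (edot u)) => [v w|]; first exact: edotDr.
  by rewrite -(scale0r 0) edotZr mul0r.
by apply: eq_bigr => i _; rewrite edotZr.
Qed.

Definition edotE := (edotDl, edotDr, edotNl, edotNr, edotZl, edotZr).

Lemma edot_ge0 u : 0 <= edot u u.
Proof. by apply: sumr_ge0 => i _; rewrite -expr2 sqr_ge0. Qed.

Lemma enorm_ge0 u : 0 <= enorm u.
Proof. exact: sqrtr_ge0. Qed.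

Lemma enorm_sqr u : enorm u ^+ 2 = edot u u.
Proof. by rewrite sqr_sqrtr // edot_ge0. Qed.

Lemma enorm0_eq0 u : enorm u = 0 -> u = 0.
Proof.
move=> u0; have : edot u u = 0 by rewrite -enorm_sqr u0 expr0n.
move/eqP; rewrite psumr_eq0 => [/allP ui0|i _]; last by rewrite -expr2 sqr_ge0.
apply/rowP => i; rewrite mxE; apply/eqP.
by have := ui0 i (mem_index_enum i); rewrite mulf_eq0 orbb.
Qed.

(** Cauchy-Schwarz: expand the nonnegative square of [enorm v *: u - enorm u *: v] and divide by the
    product of the norms. *)
Lemma edot_le u v : edot u v <= enorm u * enorm v.
Proof.
have [/enorm0_eq0 ->|u0] := eqVneq (enorm u) 0.
  by rewrite -(scale0r 0) edotZl mul0r mulr_ge0 ?enorm_ge0.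
have [/enorm0_eq0 ->|v0] := eqVneq (enorm v) 0.
  by rewrite -(scale0r 0) edotZr mul0r mulr_ge0 ?enorm_ge0.
have := edot_ge0 (enorm v *: u - enorm u *: v).
rewrite !edotE -!enorm_sqr (edotC v u) => H.
have uv0 : 0 < enorm u * enorm v by rewrite mulr_gt0 // lt0r ?u0 ?v0 enorm_ge0.
rewrite -(ler_pM2l uv0); lra.
Qed.

Lemma enorm_le u r : 0 <= r -> (enorm u <= r) = (edot u u <= r ^+ 2).
Proof. by move=> r0; rewrite -enorm_sqr ler_pXn2r // nnegrE enorm_ge0. Qed.

Lemma enorm_ge u r : 0 <= r -> (r <= enorm u) = (r ^+ 2 <= edot u u).
Proof. by move=> r0; rewrite -enorm_sqr ler_pXn2r // nnegrE enorm_ge0. Qed.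

Lemma enormD u v : enorm (u + v) <= enorm u + enorm v.
Proof.
rewrite enorm_le ?addr_ge0 ?enorm_ge0 // !edotE (edotC v u) -!enorm_sqr.
have := edot_le u v; lra.
Qed.

Lemma enormZ a u : enorm (a *: u) = `|a| * enorm u.
Proof. by rewrite /enorm !edotE mulrA -expr2 sqrtrM ?sqr_ge0 // sqrtr_sqr. Qed.

Lemma enormN u : enorm (- u) = enorm u.
Proof. by rewrite -scaleN1r enormZ normrN1 mul1r. Qed.

Lemma edistC x y : edist x y = edist y x.
Proof. by rewrite /edist -enormN opprB. Qed.

Lemma edist_ge0 x y : 0 <= edist x y.
Proof. exact: enorm_ge0. Qed.

Lemma edistxx x : edist x x = 0.
Proof. by rewrite /edist subrr -(scale0r 0) enormZ normr0 mul0r. Qed.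

Lemma edist0_eq x y : edist x y = 0 -> x = y.
Proof. by move=> /enorm0_eq0/eqP; rewrite subr_eq0 => /eqP. Qed.

Lemma edist_triangle y x z : edist x z <= edist x y + edist y z.
Proof. by rewrite /edist -[x - z](subrKA y) enormD. Qed.

(** The matrix norm is the sup norm, which carries the topology; this bound and [enorm_le_mx_norm]
    transfer continuity and compactness to [enorm]. *)
Lemma le_mx_norm_enorm u : `|u| <= enorm u.
Proof.
have [->|] := eqVneq `|u| 0; first exact: enorm_ge0.
move/mx_norm_neq0 => [[j i] /= uE]; rewrite [`|u|]uE (ord1 j).
rewrite enorm_ge // real_normK ?num_real // /edot (bigD1 i) //= expr2 lerDl.
by apply: sumr_ge0 => k _; rewrite -expr2 sqr_ge0.
Qed.

Lemma enorm_le_mx_norm u : enorm u <= d%:R * `|u|.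
Proof.
rewrite enorm_le ?mulr_ge0 // exprMn.
apply: (@le_trans _ _ (d%:R * `|u| ^+ 2)); last first.
  rewrite ler_wpM2r ?sqr_ge0 // -natrX ler_nat.
  by case: (d) => // n; rewrite leq_pmulr.
rewrite -[d in d%:R]card_ord mulr_natl -sumr_const; apply: ler_sum => i _.
rewrite -expr2 -[_ ^+ 2]real_normK ?num_real // ler_pXn2r ?nnegrE //.
by rewrite [X in _ <= X]mx_normrE (le_bigmax _ (fun ij => `|u ij.1 ij.2|) (0, i)).
Qed.

(** * Lipschitz functions and attained maxima *)

Definition elipschitz (c : R) (f : 'rV[R]_d -> R) :=
  forall x y, f x <= f y + c * edist x y.

Lemma elipschitz_continuous c f : 0 <= c -> elipschitz c f -> continuous f.
Proof.
move=> c0 fL x; apply/(@cvgrPdist_lt _ R^o _ (nbhs x)) => e e0.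
have k0 : 0 < c * d%:R + 1 by rewrite ltr_wpDl // mulr_ge0.
apply/nbhs_ballP; exists (e / (c * d%:R + 1)); first exact: divr_gt0.
move=> y; rewrite -ball_normE /= ltr_pdivlMr // => xy.
have : c * edist x y < e.
  have := ler_wpM2l c0 (enorm_le_mx_norm (x - y)); rewrite -/(edist x y).
  by have := normr_ge0 (x - y); lra.
have := fL x y; have := fL y x; rewrite (edistC y x) ltr_norml; lra.
Qed.

(** Heine-Borel: [K] is closed and bounded for the sup norm, hence compact, and [f] is
    continuous. *)
Lemma eclosed_EVT_max c f K x0 r : 0 <= c -> elipschitz c f ->
    eclosed K -> K x0 -> (forall x, K x -> edist x x0 <= r) ->
  exists2 y, K y & forall x, K x -> f x <= f y.
Proof.
move=> c0 fL Kc Kx0 Kr.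
have Kcl : closed K.
  rewrite -[K]setCK; apply: open_closedC.
  rewrite openE => x nKx; have [e e0 eK] := Kc x nKx.
  have d0 : 0 < (d%:R + 1 : R) by rewrite ltr_wpDl.
  apply/nbhs_ballP; exists (e / (d%:R + 1)); first exact: divr_gt0.
  move=> y; rewrite -ball_normE /= ltr_pdivlMr // => xy Ky.
  suff : (eball x e `&` K) y by rewrite eK.
  split => //; rewrite /eball /= edistC /edist.
  have := enorm_le_mx_norm (x - y); have := normr_ge0 (x - y); lra.
have Kb : bounded_set K.
  exists (r + `|x0|); split; first exact: num_real.
  move=> M rM x Kx; apply: le_trans (ltW rM).
  rewrite -[x](subrK x0) (le_trans (ler_normD _ _)) // lerD2r.
  exact: le_trans (le_mx_norm_enorm _) (Kr _ Kx).
have [||y yK ymax] := @EVT_max_rV R d f K _ (bounded_closed_compact Kb Kcl).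
- by exists x0.
- by apply: continuous_subspaceT; exact: elipschitz_continuous fL.
exists y; first by rewrite inE in yK.
by move=> x Kx; apply: ymax; rewrite inE.
Qed.

End Euclidean.

(** * The distance function of a set and its growth *)

Section Distance.
Variables (R : realType) (d : nat).
Implicit Types (u v w x y z p : 'rV[R]_d) (A K : set 'rV[R]_d).

(** [inf] takes the value 0 on the empty set, so lower bounds on [setdist] are proved under
    [A !=set0]. *)
Definition setdist A x : R := inf [set edist x b | b in A].

Lemma setdist_le A x b : A b -> setdist A x <= edist x b.
Proof.
move=> Ab; apply: ge_inf; last by exists b.
by exists 0 => _ [c _ <-]; exact: edist_ge0.
Qed.

Lemma le_setdist A x r :
  A !=set0 -> (forall b, A b -> r <= edist x b) -> r <= setdist A x.
Proof.
move=> [a Aa] rb; apply: lb_le_inf; first by exists (edist x a), a.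
by move=> _ [b Ab <-]; exact: rb.
Qed.

Lemma setdist_nearest A x p : is_nearest A x p -> setdist A x = edist x p.
Proof.
move=> [Ap pmin]; apply/eqP; rewrite eq_le setdist_le //=.
by apply: le_setdist => //; exists p.
Qed.

Lemma setdist_lipschitz A : A !=set0 -> elipschitz 1 (setdist A).
Proof.
move=> A0 x y; rewrite mul1r -lerBlDr; apply: le_setdist => // b Ab.
by have := setdist_le x Ab; have := edist_triangle y x b; lra.
Qed.

Lemma edist_lipschitz x : elipschitz 1 (edist x).
Proof.
by move=> y z; rewrite mul1r (edistC y); exact: edist_triangle.
Qed.

Lemma eclosedI A K : eclosed A -> eclosed K -> eclosed (A `&` K).
Proof.
move=> Ac Kc x /not_andP[/Ac|/Kc] [r r0 rE]; exists r => //.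
  by rewrite setIA rE set0I.
by rewrite (setIC A) setIA rE set0I.
Qed.

Lemma eclosed_sublevel (f : 'rV[R]_d -> R) r :
  elipschitz 1 f -> eclosed [set x | f x <= r].
Proof.
move=> fL x /negP; rewrite -ltNge => rfx.
exists (f x - r); first by rewrite subr_gt0.
apply/seteqP; split => // y [] /=; rewrite /eball /= edistC.
have := fL x y; lra.
Qed.

Lemma elipschitzN c (f : 'rV[R]_d -> R) :
  elipschitz c f -> elipschitz c (fun x => - f x).
Proof. by move=> fL x y; have := fL y x; rewrite (edistC y); lra. Qed.

(** The points of [A] at least [e] from [p] and within [edist z p + 1] of [z] form a compact set.
    Its point closest to [z] is not [p], so by uniqueness it is strictly farther than [p]; all other
    far points exceed by 1. *)
Lemma nearest_separated A z p e : eclosed A -> is_nearest A z p ->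
    (forall q, is_nearest A z q -> q = p) -> 0 < e ->
  exists2 g, 0 < g & forall b, A b -> e <= edist b p ->
    edist z p + g <= edist z b.
Proof.
move=> Ac [Ap pmin] puniq e0.
pose K := A `&` ([set b | - edist p b <= - e] `&`
                 [set b | edist z b <= edist z p + 1]).
have Kc : eclosed K.
  apply: eclosedI => //; apply: eclosedI; apply: eclosed_sublevel.
    exact: elipschitzN (edist_lipschitz p).
  exact: edist_lipschitz.
have [[b0 Kb0]|K0] := pselect (K !=set0); last first.
  exists 1 => // b Ab eb; rewrite leNgt; apply/negP => zb.
  apply: K0; exists b; split => //; split => /=; last exact: ltW.
  by rewrite lerN2 edistC.
have [||q [Aq [/= qe qz]] qmin] := @eclosed_EVT_max _ _ 1 (fun b => - edist z b)
    K b0 (edist z p + 1 + edist z b0) ler01 _ Kc Kb0.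
- exact: elipschitzN (edist_lipschitz z).
- move=> b [_ [_ /= zb]]; have := edist_triangle z b b0.
  by rewrite (edistC b z); lra.
have pq : edist z p < edist z q.
  rewrite lt_neqAle pmin // andbT; apply/eqP => pq.
  have qp : q = p by apply: puniq; split => // b Ab; rewrite -pq pmin.
  by move: qe; rewrite qp edistxx; lra.
exists (Num.min 1 (edist z q - edist z p)); first by rewrite lt_min ltr01 subr_gt0.
move=> b Ab eb; rewrite addrC -lerBrDr ge_min.
have [zb|zb] := leP (edist z b) (edist z p + 1); last by apply/orP; left; lra.
apply/orP; right.
suff Kb : K b by have := qmin b Kb; lra.
by split => //; split => //=; rewrite lerN2 edistC.
Qed.

(* The one-sided derivative of the distance at [z] in the direction away from
   its unique nearest point is at least 1. *)
Lemma setdist_growth A z c : eclosed A -> Unp A z -> 0 < setdist A z ->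
    0 <= c < 1 ->
  exists2 w, enorm w = 1 & forall e, 0 < e -> exists h,
    [/\ 0 < h, h < e & setdist A z + c * h <= setdist A (z + h *: w)].
Proof.
move=> Ac [p [pN puniq]] + /andP[c0 c1]; rewrite (setdist_nearest pN).
set D := edist z p => D0; have [Ap pmin] := pN.
have Dn : D != 0 by rewrite gt_eqF.
pose w := D^-1 *: (z - p).
have wE : z - p = D *: w by rewrite scalerA divff // scale1r.
have w1 : enorm w = 1.
  by rewrite enormZ gtr0_norm ?invr_gt0 // -/(edist z p) mulVf.
clearbody w; exists w => // e e0.
(* The cut-off [(1 - c) * D] is such that every [b] closer to [p] satisfies
   [c * D <= edot w (z - b)]. *)
have [g g0 gsep] : exists2 g, 0 < g & forall b, A b -> (1 - c) * D <= edist b p ->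
    D + g <= edist z b.
  by apply: nearest_separated => //; rewrite mulr_gt0 // subr_gt0.
have [h [h0 he hg]] : exists h, [/\ 0 < h, h < e & h < g / 2].
  exists (Num.min (e / 2) (g / 4)).
  by rewrite lt_min !gt_min; split; [|apply/orP; left|apply/orP; right]; lra.
exists h; split => //; apply: le_setdist; first by exists p.
move=> b Ab; have [bp|bp] := leP ((1 - c) * D) (edist b p).
  (* Far from [p]: the shift costs at most [h], and [h + c * h <= 2 * h < g]. *)
  have := gsep b Ab bp; have := edist_triangle (z + h *: w) z b.
  have -> : edist z (z + h *: w) = h.
    by rewrite edistC /edist addrC addKr enormZ w1 mulr1 gtr0_norm.
  have : c * h <= h by nra.
  lra.
(* Near [p]: compare squares term by term with [(D + c * h) ^+ 2]; the cross term is controlled by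
   the cut-off. *)
rewrite enorm_ge; last by nra.
have -> : z + h *: w - b = (z - b) + h *: w by rewrite addrAC.
have zb := pmin b Ab; rewrite -/D in zb.
have wzb : D - edist b p <= edot w (z - b).
  have -> : z - b = D *: w - (b - p) by rewrite -wE opprB subrKA.
  rewrite edotDr edotNr edotZr -enorm_sqr w1.
  by have := edot_le w (b - p); rewrite w1 mul1r -/(edist b p); lra.
rewrite /edist in zb; move: (z - b) zb wzb => q zb wzb.
rewrite !edotE -!enorm_sqr w1 (edotC q w).
have hw : h * (c * D) <= h * edot w q by rewrite ler_pM2l //; lra.
have Dq : D ^+ 2 <= enorm q ^+ 2 by rewrite ler_pXn2r // nnegrE ?enorm_ge0 // ltW.
have ch : c ^+ 2 * h ^+ 2 <= h ^+ 2 by rewrite ler_piMl ?sqr_ge0 // expr_le1 // ltW.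
lra.
Qed.

(** * Enlarging a ball that touches the set *)

Lemma enorm_collinear x v t h : enorm v = 1 -> 0 < t -> 0 <= h ->
  enorm x <= h -> t + h <= enorm (x + t *: v) -> x = h *: v.
Proof.
move=> v1 t0 h0; rewrite enorm_le // enorm_ge; last by lra.
rewrite !edotE (edotC v x) -(enorm_sqr v) v1 => xh xt.
apply/eqP; rewrite -subr_eq0; apply/eqP/enorm0_eq0/eqP.
rewrite eq_le enorm_ge0 enorm_le // andbT expr0n /=.
rewrite !edotE (edotC v x) -(enorm_sqr v) v1.
(* Equality case of the triangle inequality: subtracting the squared bounds leaves
   [t * h <= t * edot x v], and then the square of [x - h *: v] is at most 0. *)
have xv : h <= edot x v by rewrite -(ler_pM2l t0); lra.
nra.
Qed.

Lemma nearest_extend A a v t s : eclosed A -> A a -> enorm v = 1 ->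
    0 < t -> t < s ->
    (forall z, edist z a <= s -> Unp A z) ->
    (forall b, A b -> t <= edist (a + t *: v) b) ->
  forall b, A b -> s <= edist (a + s *: v) b.
Proof.
move=> Ac Aa v1 t0 ts AU tb; set x0 := a + t *: v.
have A0 : A !=set0 by exists a.
pose h := s - t; have h0 : 0 < h by rewrite subr_gt0.
pose K := [set z | edist x0 z <= h].
have Kc : eclosed K by apply: eclosed_sublevel; exact: edist_lipschitz.
have Kx0 : K x0 by rewrite /K /= edistxx ltW.
have Kb x : K x -> edist x x0 <= h by rewrite edistC.
have dx0 : t <= setdist A x0 by exact: le_setdist.
have x0a : edist x0 a = t.
  by rewrite /edist addrC addKr enormZ v1 mulr1 gtr0_norm.
have [y Ky ymax] := eclosed_EVT_max ler01 (setdist_lipschitz A0) Kc Kx0 Kb.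
(* Penalise the distance to [x0]: by growth the maximum of
   [setdist A z - c * edist z x0] over the ball is on the sphere. *)
have yc c : 0 <= c < 1 -> t + c * h <= setdist A y.
  move=> /andP[c0 c1].
  pose f z := setdist A z - c * edist x0 z.
  have fL : elipschitz 2 f.
    move=> x z; rewrite /f; have := setdist_lipschitz A0 x z.
    have := edist_triangle x x0 z; have := edist_ge0 x z; nra.
  have [z Kz zmax] := eclosed_EVT_max (ler0n R 2) fL Kc Kx0 Kb.
  have := zmax x0 Kx0; rewrite /f edistxx => zx0.
  have [zh|] := leP h (edist x0 z).
    have := ymax z Kz; have : c * h <= c * edist x0 z by rewrite ler_wpM2l.
    lra.
  move=> zh; exfalso.
  have zU : Unp A z.
    apply: AU; have := edist_triangle x0 z a; rewrite (edistC z x0) x0a /h in zh *.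
    lra.
  have dz0 : 0 < setdist A z by have := edist_ge0 x0 z; nra.
  (* The rate [(1 + c) / 2] exceeds [c], so a step along [w] that stays in the ball raises [f] above
     its maximum. *)
  have [|w w1 wg] := @setdist_growth A z ((1 + c) / 2) Ac zU dz0; first by lra.
  have [e [e0 eh ge]] : exists e, [/\ 0 < e, e < h - edist x0 z &
      setdist A z + (1 + c) / 2 * e <= setdist A (z + e *: w)].
    by apply: wg; rewrite subr_gt0.
  have zw : edist z (z + e *: w) = e.
    by rewrite edistC /edist addrC addKr enormZ w1 mulr1 gtr0_norm.
  have x0w := edist_triangle z x0 (z + e *: w); rewrite zw in x0w.
  have Kzw : K (z + e *: w) by rewrite /K /=; lra.
  by have := zmax _ Kzw; rewrite /f; nra.
have yh : t + h <= setdist A y.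
  rewrite leNgt; apply/negP => yth.
  have ty : t <= setdist A y by have := yc 0; rewrite mul0r addr0 lexx ltr01; exact.
  (* Midpoint between 1 and the rate realised by [y]; [yc] at this [c] contradicts [yth]. *)
  pose c := ((setdist A y - t) / h + 1) / 2.
  have q0 : 0 <= (setdist A y - t) / h by rewrite divr_ge0 ?subr_ge0 // ltW.
  have q1 : (setdist A y - t) / h < 1 by rewrite ltr_pdivrMr //; lra.
  have : t + c * h <= setdist A y by apply: yc; rewrite /c; lra.
  rewrite /c mulrAC mulrDl divfK ?gt_eqF //; lra.
(* [y] is within [h] of [x0] but at least [t + h] from [a]. *)
have yE : y - x0 = h *: v.
  apply: (enorm_collinear v1 t0 (ltW h0)); first by rewrite -/(edist y x0) Kb.
  apply: le_trans (le_trans yh (setdist_le y Aa)) _.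
  by rewrite /edist /x0 opprD addrA addrNK.
have -> : a + s *: v = y.
  by rewrite -[y](subrK x0) yE /x0 addrCA -scalerDl subrK.
move=> b Ab; have := setdist_le y Ab; rewrite /h in yh; lra.
Qed.

(** [Unp] is available only on the open ball, so [nearest_extend] is applied at radius [Rad - m],
    with [m] small against the depth of [b] in the limit ball. *)
Lemma nearest_inflate A a v t Rad : eclosed A -> A a -> enorm v = 1 ->
    0 < t -> t < Rad ->
    (forall z, edist z a < Rad -> Unp A z) ->
    (forall b, A b -> t <= edist (a + t *: v) b) ->
  A `&` eball (a + Rad *: v) Rad = set0.
Proof.
move=> Ac Aa v1 t0 tR AU tb; apply/seteqP; split => // b [Ab] /=.
rewrite /eball /= edistC; set e := edist _ b => eR.
have [m [m0 me mt]] : exists m, [/\ 0 < m, m < (Rad - e) / 2 & m < Rad - t].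
  exists (Num.min ((Rad - e) / 4) ((Rad - t) / 2)).
  by rewrite lt_min !gt_min; split; [|apply/orP; left|apply/orP; right]; lra.
have sb : Rad - m <= edist (a + (Rad - m) *: v) b.
  apply: (nearest_extend Ac Aa v1 t0) => //; first by lra.
  by move=> z za; apply: AU; lra.
have := edist_triangle (a + Rad *: v) (a + (Rad - m) *: v) b.
have -> : edist (a + (Rad - m) *: v) (a + Rad *: v) = m.
  rewrite /edist opprD addrACA subrr add0r -scalerBl enormZ v1 mulr1.
  by rewrite addrAC subrr add0r normrN gtr0_norm.
rewrite -/e; lra.
Qed.

End Distance.

(** * Consequences of the lower bound on the reach *)

Section Reach.
Variables (R : realType) (d : nat) (Rad : R) (A : set 'rV[R]_d).
Hypotheses (Rad0 : 0 < Rad) (Ac : eclosed A) (AR : (Rad%:E <= reach A)%E).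
Implicit Types (a b v z : 'rV[R]_d).

(** A supremum strictly above [edist z a] provides an admissible [rho] above it. *)
Lemma reach_Unp a z : A a -> edist z a < Rad -> Unp A z.
Proof.
move=> Aa za.
have : ((edist z a)%:E < reach_at A a)%E.
  apply: (@lt_le_trans _ _ Rad%:E); first by rewrite lte_fin.
  by apply: le_trans AR _; apply: ereal_inf_lbound; exists a.
by move=> /ereal_sup_gt[_ [rho [rho0 rhoU] <-]]; rewrite lte_fin => /rhoU.
Qed.

Lemma boundary_mem a : boundary A a -> A a.
Proof.
move=> aA; apply: contrapT => /Ac[r r0 rA].
by have [[b]] := aA r r0; rewrite rA.
Qed.

(** Squaring cancels [s ^+ 2] and leaves a condition linear in [v], suited to nonnegative
    combinations of normals. *)
Lemma ge_edist_normal a v b s : enorm v = 1 -> 0 <= s ->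
  (s <= edist (a + s *: v) b) =
  (2 * s * edot (b - a) v <= edot (b - a) (b - a)).
Proof.
move=> v1 s0; have -> : edist (a + s *: v) b = enorm (s *: v - (b - a)).
  by rewrite /edist opprB addrCA addrA.
rewrite enorm_ge //; move: (b - a) => q.
rewrite !edotE -(enorm_sqr v) v1 (edotC v q).
by rewrite -subr_ge0 -[RHS]subr_ge0; congr (0 <= _); ring.
Qed.

Lemma normal_cone_RP a v : normal_cone_R Rad A a v <->
  enorm v = 1 /\ forall b, A b ->
    2 * Rad * edot (b - a) v <= edot (b - a) (b - a).
Proof.
split=> -[v1 vA]; split => //.
  move=> b Ab; rewrite -(ge_edist_normal a b v1 (ltW Rad0)) leNgt; apply/negP => bR.
  suff : (A `&` eball (a + Rad *: v) Rad) b by rewrite vA.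
  by split => //; rewrite /eball /= edistC.
apply/seteqP; split => // b [/vA]; rewrite -(ge_edist_normal a b v1 (ltW Rad0)).
by rewrite /eball /= edistC leNgt => /negP.
Qed.

(** If [y] is at least [Rad] from [A], it is itself the centre. Otherwise the ball around [y]
    touching [A] at its nearest point is enlarged to radius [Rad]; the new centre is [Rad - t] away
    from [y]. *)
Lemma reach_Rbody : A !=set0 -> Rbody Rad A.
Proof.
move=> A0 y nAy.
have [[b Ab yb]|yA] := pselect (exists2 b, A b & edist y b < Rad); last first.
  exists y; rewrite /eball /= edistxx; split => //.
  apply/seteqP; split => // b [/=]; rewrite edistC => yb Ab.
  by apply: yA; exists b.
have [a [[Aa amin] _]] := reach_Unp Ab yb.
set t := edist y a in amin.
have t0 : 0 < t.
  rewrite lt_neqAle edist_ge0 andbT; apply/eqP => /esym/edist0_eq ya.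
  by apply: nAy; rewrite ya.
have tR : t < Rad by exact: le_lt_trans (amin b Ab) yb.
pose v := t^-1 *: (y - a).
have v1 : enorm v = 1 by rewrite enormZ gtr0_norm ?invr_gt0 // mulVf ?gt_eqF.
have yE : y = a + t *: v by rewrite scalerA divff ?gt_eqF // scale1r addrC subrK.
exists (a + Rad *: v); split; last first.
  rewrite setIC; apply: (nearest_inflate Ac Aa v1 t0 tR); last by rewrite -yE.
  by move=> z; exact: reach_Unp.
rewrite /eball /= yE /edist opprD addrACA subrr add0r -scalerBl enormZ v1 mulr1.
by rewrite ltr_norml; lra.
Qed.

(* A unit vector [\sum_i w i * lam i *: v i] satisfies the inequality of
   [normal_cone_RP] at radius [Rad / s], where [s = \sum_i w i * lam i] may
   exceed 1; the reach hypothesis then enlarges this radius to [Rad]. *)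
Lemma reach_spherically_convex a :
  boundary A a -> spherically_convex (normal_cone_R Rad A a).
Proof.
move=> /boundary_mem Aa; apply/seteqP; split => [x|v vN]; last first.
  split; last by case: vN.
  exists 1%N, (fun=> 1), (fun=> v); rewrite !big_ord1 scale1r.
  by split => // _; exists 1, v; rewrite scale1r.
move=> [[n [w [p [w0 _ pK ->]]]]].
set x' := \sum_(i < n) _; move=> x1; change (enorm x' = 1) in x1.
have [lam [u [lam0 uN pE]]] : exists lam u, [/\ forall i, 0 <= lam i,
    forall i, normal_cone_R Rad A a (u i) & forall i, p i = lam i *: u i].
  have [lam lamP] := choice pK; have [u uP] := choice lamP.
  by exists lam, u; split=> i; have [] := uP i.
pose s := \sum_(i < n) w i * lam i.
have s0 : 0 <= s by apply: sumr_ge0 => i _; rewrite mulr_ge0.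
have xb b : A b -> 2 * Rad * edot (b - a) x' <= s * edot (b - a) (b - a).
  move=> Ab; rewrite edot_sumr mulr_sumr mulr_suml; apply: ler_sum => i _.
  have [_ /(_ b Ab) ub] := (normal_cone_RP a (u i)).1 (uN i).
  rewrite pE edotZr; have := ler_wpM2l (mulr_ge0 (w0 i) (lam0 i)) ub; lra.
(* Dividing by [s + 1] avoids a zero denominator and gives [t < Rad] unless [s = 0]; in that case
   [xb] bounds the left side by 0. *)
pose t := Rad / (s + 1).
have s1 : 0 < s + 1 by lra.
have t0 : 0 < t by exact: divr_gt0.
have [tR|tR] := ltP t Rad; last first.
  have s00 : s = 0.
    move: tR; rewrite ler_pdivlMr // => tR.
    by apply/eqP; rewrite eq_le s0 andbT -(ler_pM2l Rad0); lra.
  apply/normal_cone_RP; split => // b Ab; have := xb b Ab.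
  by rewrite s00 mul0r => /le_trans; apply; exact: edot_ge0.
split => //; apply: (nearest_inflate Ac Aa x1 t0 tR).
  by move=> z; exact: reach_Unp.
move=> b Ab; rewrite (ge_edist_normal a b x1 (ltW t0)) -(ler_pM2r s1).
have -> : 2 * t * edot (b - a) x' * (s + 1) = 2 * Rad * edot (b - a) x'.
  by rewrite /t; field; rewrite gt_eqF.
apply: le_trans (xb b Ab) _.
by rewrite mulrDr mulr1 [X in _ <= X + _]mulrC lerDl edot_ge0.
Qed.

End Reach.

Theorem mainTheorem18 (R : realType) (d : nat) (Rad : R) (A : set 'rV[R]_d) :
  (2 <= d)%N -> 0 < Rad -> body A -> (Rad%:E <= reach A)%E ->
  Rbody Rad A /\
  (forall a, boundary A a -> spherically_convex (normal_cone_R Rad A a)).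
Proof.
move=> _ Rad0 [A0 Ac] AR; split; first exact: reach_Rbody.
by move=> a; exact: reach_spherically_convex.
Qed.
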